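(* Let $\mathcal{S}$ be a unipotent numerical monoid in $G$. If one of the following conditions holds, then $\mathcal{S}$ is irreducible: (1) $|\mathtt{F}_l(\mathcal{S})|=1$ and for every $A\in G(\mathbb{N})\setminus\mathcal{S}$ we have $\mathtt{F}_l(\mathcal{S})\cap A\mathcal{S}\neq\emptyset$; (2) $|\mathtt{F}_r(\mathcal{S})|=1$ and for every $A\in G(\mathbb{N})\setminus\mathcal{S}$ we have $\mathtt{F}_r(\mathcal{S})\cap\mathcal{S}A\neq\emptyset$; (3) $|\mathtt{F}_t(\mathcal{S})|=1$ and for every $A\in G(\mathbb{N})\setminus\mathcal{S}$ we have $\mathtt{F}_t(\mathcal{S})\cap\mathcal{S}A\cap A\mathcal{S}\neq\emptyset$.
   Context: Setting: $n$ is a positive integer, $\mathbf{U}(n,\mathbb{C})$ is the group of upper triangular unipotent $n\times n$ complex matrices, and $G$ is a (Zariski) closed subgroup of it. $G_{\mathbb{Z}}$ is the group of matrices in $G$ with integer entries, and $G(\mathbb{N})$ is the monoid of matrices in $G_{\mathbb{Z}}$ all of whose entries lie in $\mathbb{N}=\{0,1,2,\dots\}$. Standing assumptions: the monoid $G(\mathbb{N})$ is finitely generated and $G_{\mathbb{Z}}$ is its group completion. $\mathbf{1}_n$ is the identity matrix; for $\mathcal{X}\subseteq G(\mathbb{N})$, $\mathcal{X}^*:=\mathcal{X}\setminus\{\mathbf{1}_n\}$; $A\mathcal{X}:=\{AX\mid X\in\mathcal{X}\}$, and similarly $\mathcal{X}A$. A unipotent numerical monoid in $G$ is a finitely generated submonoid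 $\mathcal{S}\subseteq G(\mathbb{N})$ (containing $\mathbf{1}_n$) such that $G(\mathbb{N})\setminus\mathcal{S}$ is finite. $\mathcal{S}$ is irreducible if there are no two unipotent numerical monoids $\mathcal{T}_1,\mathcal{T}_2$ in $G$, each properly containing $\mathcal{S}$, with $\mathcal{T}_1\cap\mathcal{T}_2=\mathcal{S}$. Frobenius sets: $\mathtt{F}_l(\mathcal{S}):=\{A\in G(\mathbb{N})\mid A\notin\mathcal{S},\ A\,G(\mathbb{N})^*\subseteq\mathcal{S}\}$; $\mathtt{F}_r(\mathcal{S}):=\{A\in G(\mathbb{N})\mid A\notin\mathcal{S},\ G(\mathbb{N})^*A\subseteq\mathcal{S}\}$; $\mathtt{F}_t(\mathcal{S}):=\mathtt{F}_l(\mathcal{S})\cap\mathtt{F}_r(\mathcal{S})$. *)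

(* Defs.v *)
From mathcomp Require Import all_boot all_order all_algebra.
From mathcomp Require Import complex.
From mathcomp Require Import boolp classical_sets functions cardinality reals.
From mathcomp Require mpoly.

Set Implicit Arguments.
Unset Strict Implicit.
Unset Printing Implicit Defensive.

Import GRing.Theory Num.Theory.

Local Open Scope classical_set_scope.
Local Open Scope ring_scope.

Definition unipotent_upper (R : realType) (n : nat) : set 'M[R[i]]_n :=
  [set A : 'M[R[i]]_n | (forall i, A i i = 1) /\ (forall i j : 'I_n, (j < i)%N -> A i j = 0)].

(* Matrices are points of affine space through mxvec; the variable attached to
   the (i, j) entry has index mxvec_index i j. The ambient space is the space
   of all matrices: since the unipotent group is itself closed there, its
   subsets closed in either space are the same. *)
Definition zariski_closed (R : realType) (n : nat) (G : set 'M[R[i]]_n) : Prop :=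
  exists I : set (mpoly.mpoly (n * n) R[i]),
    G = [set A : 'M[R[i]]_n | forall p, I p -> mpoly.meval (mxvec A 0) p = 0].

Definition is_submonoid (R : realType) (n : nat) (M : set 'M[R[i]]_n) : Prop :=
  M 1%:M /\ (forall A B, M A -> M B -> M (A *m B)).

Definition closed_unipotent_subgroup (R : realType) (n : nat)
    (G : set 'M[R[i]]_n) : Prop :=
  [/\ G `<=` @unipotent_upper R n, is_submonoid G,
      forall A, G A -> G (invmx A) & zariski_closed G].

Definition int_points (R : realType) (n : nat) (G : set 'M[R[i]]_n) :
    set 'M[R[i]]_n :=
  [set A | G A /\ forall i j, exists m : int, A i j = m%:~R].

Definition nat_points (R : realType) (n : nat) (G : set 'M[R[i]]_n) :
    set 'M[R[i]]_n :=
  [set A | int_points G A /\ forall i j, exists m : nat, A i j = m%:R].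

Definition finitely_generated (R : realType) (n : nat) (M : set 'M[R[i]]_n) :
    Prop :=
  exists2 X : set 'M[R[i]]_n,
    finite_set X & M = smallest (@is_submonoid R n) X.

(* Functions are total on matrices; only their values on M are relevant. *)
Definition monoid_morphism_on (R : realType) (n : nat) (M : set 'M[R[i]]_n)
    (H : groupType) (f : 'M[R[i]]_n -> H) : Prop :=
  f 1%:M = 1%g /\ (forall A B, M A -> M B -> f (A *m B) = (f A * f B)%g).

(* Universal property of the inclusion of the monoid M in the group K: every
   monoid morphism from M to a group extends uniquely to K. *)
Definition is_group_completion (R : realType) (n : nat)
    (M K : set 'M[R[i]]_n) : Prop :=
  M `<=` K /\
  forall (H : groupType) (f : 'M[R[i]]_n -> H), monoid_morphism_on M f ->
    (exists2 g : 'M[R[i]]_n -> H,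
       monoid_morphism_on K g & (forall A, M A -> g A = f A)) /\
    (forall g1 g2 : 'M[R[i]]_n -> H,
       monoid_morphism_on K g1 -> (forall A, M A -> g1 A = f A) ->
       monoid_morphism_on K g2 -> (forall A, M A -> g2 A = f A) ->
       forall A, K A -> g1 A = g2 A).

Definition unipotent_numerical_monoid (R : realType) (n : nat)
    (G S : set 'M[R[i]]_n) : Prop :=
  [/\ S `<=` nat_points G, is_submonoid S, finitely_generated S
    & finite_set (nat_points G `\` S)].

Definition irreducible_monoid (R : realType) (n : nat)
    (G S : set 'M[R[i]]_n) : Prop :=
  ~ exists T1 T2 : set 'M[R[i]]_n,
      [/\ unipotent_numerical_monoid G T1, unipotent_numerical_monoid G T2,
          S `<` T1, S `<` T2 & T1 `&` T2 = S].

Definition star (R : realType) (n : nat) (X : set 'M[R[i]]_n) :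
  set 'M[R[i]]_n := X `\ 1%:M.

Definition lmulset (R : realType) (n : nat) (A : 'M[R[i]]_n)
  (X : set 'M[R[i]]_n) : set 'M[R[i]]_n := [set A *m B | B in X].

Definition rmulset (R : realType) (n : nat) (X : set 'M[R[i]]_n)
  (A : 'M[R[i]]_n) : set 'M[R[i]]_n := [set B *m A | B in X].

Definition frobenius_l (R : realType) (n : nat) (G S : set 'M[R[i]]_n) :
    set 'M[R[i]]_n :=
  [set A | [/\ nat_points G A, ~ S A & lmulset A (star (nat_points G)) `<=` S]].

Definition frobenius_r (R : realType) (n : nat) (G S : set 'M[R[i]]_n) :
    set 'M[R[i]]_n :=
  [set A | [/\ nat_points G A, ~ S A & rmulset (star (nat_points G)) A `<=` S]].

Definition frobenius_t (R : realType) (n : nat) (G S : set 'M[R[i]]_n) :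
    set 'M[R[i]]_n :=
  frobenius_l G S `&` frobenius_r G S.

(* Main.v *)
(* If a set F disjoint from S has one element and meets every unipotent
   numerical monoid properly containing S, then that element lies in every
   intersection of two such monoids, so the intersection is not S. An
   A in T \ S puts an element of F in T, namely one in A S or in S A. *)
Require Import Defs.
From mathcomp Require Import all_boot all_order all_algebra.
From mathcomp Require Import complex.
From mathcomp Require Import boolp classical_sets functions cardinality reals.

Local Open Scope classical_set_scope.
Local Open Scope card_scope.

Lemma irreducible_of_singleton_meet {R : realType} {n : nat}
    {G S F : set 'M[R[i]]_n} :
  F #= `I_1 -> F `&` S = set0 ->
  (forall T, unipotent_numerical_monoid G T -> S `<` T -> F `&` T !=set0) ->
  irreducible_monoid G S.
Proof.
move=> F1 FS0 FT [T1 [T2 [T1num T2num ST1 ST2 T12]]].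
have [X [FX T1X]] := FT T1 T1num ST1.
have [Y [FY T2Y]] := FT T2 T2num ST2.
(* The cardinality hypothesis gives an injection [f] of [F] into [I_1], whose only element is 0. So
   [f] is constant on [F], and injectivity forces [X = Y]. *)
have /card_set_bijP [f [fF f_inj _]] := F1.
have f0 Z : F Z -> f Z = 0%N by move=> /fF; case: (f Z).
have XY : X = Y by apply: f_inj; rewrite ?inE // !f0.
suff : (F `&` S) X by rewrite FS0.
by split=> //; rewrite -T12; split=> //; rewrite XY.
Qed.

(** Supplies the gaps of [S] at which the conditions on [A] are applied. *)
Lemma proper_numerical_monoid_witness {R : realType} {n : nat}
    {G S T : set 'M[R[i]]_n} :
  unipotent_numerical_monoid G T -> S `<` T ->
  exists2 A, T A & (nat_points G `\` S) A.
Proof.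
move=> [TN _ _ _] [_ /nonsubset [A [TA SA]]].
by exists A => //; split=> //; apply: TN.
Qed.

Theorem theorem1p3 (R : realType) (n : nat) (n_gt0 : (0 < n)%N)
    (G : set 'M[R[i]]_n)
    (G_closed : closed_unipotent_subgroup G)
    (GN_fg : finitely_generated (nat_points G))
    (GZ_completion : is_group_completion (nat_points G) (int_points G))
    (S : set 'M[R[i]]_n)
    (S_num : unipotent_numerical_monoid G S)
    (S_cond :
      [\/ frobenius_l G S #= `I_1 /\
          (forall A, (nat_points G `\` S) A ->
             frobenius_l G S `&` lmulset A S !=set0),
          frobenius_r G S #= `I_1 /\
          (forall A, (nat_points G `\` S) A ->
             frobenius_r G S `&` rmulset S A !=set0)
        | frobenius_t G S #= `I_1 /\
          (forall A, (nat_points G `\` S) A ->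
             frobenius_t G S `&` rmulset S A `&` lmulset A S !=set0)]) :
  irreducible_monoid G S.
Proof.
(* [F] is left arbitrary so that this serves both [frobenius_l] and [frobenius_t]. *)
have meet_l F : (forall A, (nat_points G `\` S) A ->
      F `&` lmulset A S !=set0) ->
    forall T, unipotent_numerical_monoid G T -> S `<` T -> F `&` T !=set0.
  move=> FA T Tnum ST.
  have [A TA /FA [X [FX [B SB AB]]]] := proper_numerical_monoid_witness Tnum ST.
  have [_ [_ TM] _ _] := Tnum.
  (* Both factors of [X = A *m B] lie in [T]: [A] by choice, [B] because [S] is contained in [T]. *)
  by exists X; split=> //; rewrite -AB; apply: TM => //; apply: (properW ST).
have meet_r F : (forall A, (nat_points G `\` S) A ->
      F `&` rmulset S A !=set0) ->
    forall T, unipotent_numerical_monoid G T -> S `<` T -> F `&` T !=set0.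
  move=> FA T Tnum ST.
  have [A TA /FA [X [FX [B SB BA]]]] := proper_numerical_monoid_witness Tnum ST.
  have [_ [_ TM] _ _] := Tnum.
  by exists X; split=> //; rewrite -BA; apply: TM => //; apply: (properW ST).
case: S_cond => -[F1 FA]; apply: (irreducible_of_singleton_meet F1).
(* Frobenius elements lie outside [S] by definition, hence the disjointness in each case. *)
- by rewrite -subset0 => X [[]].
- exact: meet_l.
- by rewrite -subset0 => X [[]].
- exact: meet_r.
- by rewrite -subset0 => X [[[]]].
(* A point of the triple intersection lies in particular in [lmulset A S], so the left-hand argument
   applies. *)
- apply: meet_l => A /FA [X [[FX _] AX]].
  by exists X.
Qed.
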